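(* Let $\mathbb X=\langle X,\{\rho_i:i\in I\}\rangle$ be a countable ultrahomogeneous structure in an at most countable relational language, and suppose $\mathbb P(\mathbb X)\neq\{X\}$. Then: (a) every maximal chain $\mathcal L$ in the poset $\langle \mathbb P(\mathbb X)\cup\{\emptyset\},\subset\rangle$ is (as an order under $\subsetneq$) an $\mathbb R$-embeddable complete linear order whose least element $\emptyset$ is non-isolated; (b) if there exists a positive family $\mathcal P$ on $X$ with $\mathcal P\subset\mathbb P(\mathbb X)$, then for each countable linear order $L$ which is complete with $0_L$ non-isolated, there is a maximal chain in $\langle \mathbb P(\mathbb X)\cup\{\emptyset\},\subset\rangle$ isomorphic to $L$.
   Context: For a relational structure $\mathbb X$ with domain $X$, $\mathbb P(\mathbb X)$ is the set of all $A\subset X$ such that the induced substructure on $A$ is isomorphic to $\mathbb X$. $\mathbb X$ is countable if $|X|=\omega$, and ultrahomogeneous if every isomorphism between finite substructures extends to an automorphism. A linear order is complete if it has a least element $0_L$, a greatest element and no gaps; $0_L$ is non-isolated if it has no immediate successor; $\mathbb R$-embeddable means embeddable into $\langle\mathbb R,<\rangle$. A family $\mathcal P\subset P(X)$ (with $X$ countably infinite) is positive if: $\emptyset\notin\mathcal P$; $A\in\mathcal P$ and $A\subset B\subset X$ imply $B\in\mathcal P$; $A\in\mathcal P$ and $F$ finite imply $A\setminus F\in\mathcal P$; and some $A\in\mathcal P$ has $X\setminus A$ infinite. *)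

(* Defs.v *)
From mathcomp Require Import all_boot all_order all_algebra.
From mathcomp Require Import boolp classical_sets functions cardinality reals.

Set Implicit Arguments.
Unset Strict Implicit.
Unset Printing Implicit Defensive.

Local Open Scope classical_set_scope.
Local Open Scope ring_scope.

Record language := Language { symbol : Type; arity : symbol -> nat }.

(* A tuple of length n is a function from 'I_n. *)
Record rel_structure (Lg : language) (X : Type) := RelStructure {
  interp : forall i : symbol Lg, set ('I_(arity i) -> X)
}.
Arguments interp {Lg X} S i : rename.

Section Structures.
Variable Lg : language.

Definition isomorphism (X Y : Type) (S : rel_structure Lg X)
    (T : rel_structure Lg Y) (f : X -> Y) : Prop :=
  bijective f /\
  forall (i : symbol Lg) (t : 'I_(arity i) -> X),
    interp S i t <-> interp T i (f \o t).

Definition isomorphic (X Y : Type) (S : rel_structure Lg X)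
    (T : rel_structure Lg Y) : Prop :=
  exists f : X -> Y, isomorphism S T f.

Definition induced (X : Type) (S : rel_structure Lg X) (A : set X)
    : rel_structure Lg (set_type A) :=
  RelStructure (fun i => [set t | interp S i (fun k => val (t k))]).

Definition copies (X : Type) (S : rel_structure Lg X) : set (set X) :=
  [set A | isomorphic (induced S A) S].

Definition ultrahomogeneous (X : Type) (S : rel_structure Lg X) : Prop :=
  forall (A B : set X) (f : set_type A -> set_type B),
    finite_set A -> finite_set B ->
    isomorphism (induced S A) (induced S B) f ->
    exists g : X -> X,
      isomorphism S S g /\ forall a : set_type A, g (val a) = val (f a).

End Structures.

Definition countably_infinite (T : Type) : Prop := ([set: T] #= [set: nat])%card.

(* [lt] is always the strict order. *)
Section LinearOrders.
Variables (T : Type) (lt : T -> T -> Prop).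

Definition linear_order : Prop :=
  [/\ forall x, ~ lt x x,
      forall x y z, lt x y -> lt y z -> lt x z &
      forall x y, x <> y -> lt x y \/ lt y x].

Definition is_least (A : set T) (x : T) : Prop :=
  A x /\ forall y, A y -> y <> x -> lt x y.

Definition is_greatest (A : set T) (x : T) : Prop :=
  A x /\ forall y, A y -> y <> x -> lt y x.

Definition is_gap (A B : set T) : Prop :=
  [/\ A !=set0 /\ B !=set0,
      A `|` B = setT,
      forall a b, A a -> B b -> lt a b,
      ~ (exists x, is_greatest A x) &
      ~ (exists x, is_least B x)].

Definition complete_linear_order : Prop :=
  [/\ linear_order,
      exists x, is_least setT x,
      exists x, is_greatest setT x &
      ~ (exists A B, is_gap A B)].

Definition immediate_successor (x y : T) : Prop :=
  lt x y /\ ~ (exists z, lt x z /\ lt z y).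

Definition non_isolated (x : T) : Prop :=
  ~ (exists y, immediate_successor x y).

Definition least_non_isolated : Prop :=
  forall x, is_least setT x -> non_isolated x.

Definition R_embeddable (R : realType) : Prop :=
  exists f : T -> R, injective f /\ forall x y, lt x y <-> f x < f y.

End LinearOrders.

Definition order_isomorphic (T U : Type) (ltT : T -> T -> Prop)
    (ltU : U -> U -> Prop) : Prop :=
  exists f : T -> U, bijective f /\ forall x y, ltT x y <-> ltU (f x) (f y).

Section Families.
Variable X : Type.

Definition maximal_chain (P C : set (set X)) : Prop :=
  [/\ C `<=` P,
      total_on C (fun A B => A `<=` B) &
      forall D : set (set X), D `<=` P -> total_on D (fun A B => A `<=` B) ->
        C `<=` D -> D = C].

Definition chain_lt (C : set (set X)) (A B : set_type C) : Prop :=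
  val A `<` val B.

Definition positive_family (P : set (set X)) : Prop :=
  [/\ ~ P set0,
      forall A B, P A -> A `<=` B -> P B,
      forall A F, P A -> finite_set F -> P (A `\` F) &
      exists A, P A /\ infinite_set (~` A)].

End Families.

(* Main.v *)
Require Import Defs.
From mathcomp Require Import all_boot all_order all_algebra.
From mathcomp Require Import boolp classical_sets functions cardinality reals.

Set Implicit Arguments.
Unset Strict Implicit.
Unset Printing Implicit Defensive.

Local Open Scope classical_set_scope.

(**
A subset [A] of a countable ultrahomogeneous structure is a copy iff finite
partial isomorphisms into [A] extend by one point inside [A] (back-and-forth);
this condition passes to unions of chains, so a maximal chain of copies is
closed under unions, hence has no gaps. A least nonempty member is impossible,
since every copy properly contains another copy. Summing weights [2^-n] embeds
a chain of subsets of a countable set into the reals.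

Conversely, in a countable complete order [L] the jumps are dense, so sending
[x] to the set of jumps below [x] is strictly increasing, and the resulting
chain is maximal in the whole power set of the set of jumps. Since [0] is
non-isolated, the jumps can be labelled bijectively by [X] in such a way that
every set of jumps below some [x > 0] contains almost all of a fixed member of
the positive family, and is therefore a copy.
*)

(** * Enumerations of countable sets; finite subsets of unions of chains *)

Lemma countably_infinite_enum (T : Type) (A : set T) :
  countable A -> infinite_set A ->
  exists a : nat -> T, injective a /\ range a = A.
Proof.
move=> Ac Ai; have /card_set_bijP[f [_ finj fsurj]] := eq_card_nat Ac Ai.
have /choice[a aP] n : exists x, A x /\ f x = n.
  by have [x Ax <-] := fsurj n I; exists x.
exists a; split; first by move=> m n E; rewrite -(aP m).2 E (aP n).2.
rewrite eqEsubset; split=> [_ [n _ <-]|x Ax]; first exact: (aP n).1.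
exists (f x) => //; apply: finj (aP _).2; rewrite inE //; exact: (aP _).1.
Qed.

Lemma countably_infiniteP (T : Type) : countably_infinite T ->
  countable [set: T] /\ infinite_set [set: T].
Proof.
move=> T_nat; split; first by rewrite (eq_countable T_nat).
by move: T_nat => /eq_finite_set -> /infinite_nat.
Qed.

Lemma finite_sub_chain (T : Type) (F : set (set T)) (E : set T) :
  F !=set0 -> total_on F (fun A B => A `<=` B) -> finite_set E ->
  E `<=` \bigcup_(A in F) A -> exists A, F A /\ E `<=` A.
Proof.
move=> [A0 FA0] Ftot /(@finite_seqP {classic T})[s ->].
elim: s => [|x s IHs] sF; first by exists A0.
have [|A [FA sA]] := IHs.
  by move=> y ys; apply: sF; rewrite /= inE; apply/orP; right.
have [|B FB xB] := sF x; first by rewrite /= inE eqxx.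
by have [AB|BA] := Ftot _ _ FA FB; [exists B|exists A]; split=> // y /=;
  rewrite inE => /orP[/eqP->//|/sA]; auto.
Qed.

(** * Copies of ultrahomogeneous structures *)

Section Copies.
Variables (Lg : language) (X : Type) (S : rel_structure Lg X).
Implicit Types (e g : X -> X) (A : set X) (G : set (X * X)).

Definition embedding e : Prop :=
  injective e /\
  forall (i : symbol Lg) (t : 'I_(arity i) -> X),
    interp S i t <-> interp S i (e \o t).

Lemma embedding_id : embedding id.
Proof. by split. Qed.

Lemma embedding_comp e g : embedding e -> embedding g -> embedding (e \o g).
Proof.
move=> [einj eP] [ginj gP]; split; first exact: inj_comp.
by move=> i t; rewrite gP eP.
Qed.

Lemma isomorphism_embedding g : isomorphism S S g -> embedding g.
Proof. by move=> [/bij_inj]. Qed.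

(** Trades isomorphisms between subtypes for self-maps of [X], which can be composed. *)
Lemma copiesP A : copies S A <-> exists e, embedding e /\ range e = A.
Proof.
split=> [[f [[g fK gK] fP]]|[e [[einj eP] <-]]].
  exists (fun x => val (g x)); split; first split.
  - by move=> x y /val_inj /(can_inj gK).
  - move=> i t; have := fP i (g \o t); rewrite /= => ->.
    by rewrite (_ : f \o (g \o t) = t)//; apply/funext => k /=; rewrite gK.
  - rewrite eqEsubset; split=> [_ [x _ <-]|x Ax]; first exact: set_mem (valP _).
    by exists (f (SigSub (mem_set Ax))) => //=; rewrite fK.
have /choice[f fP] (a : set_type (range e)) : exists x, e x = val a.
  by have [x _ <-] := set_mem (valP a); exists x.
pose g x : set_type (range e) := SigSub (mem_set (imageT e x)).
exists f; split; first exists g.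
- by move=> a; apply: val_inj; rewrite /= fP.
- by move=> x; apply: einj; rewrite fP.
- move=> i t; rewrite eP /= (_ : e \o (f \o t) = (fun k => val (t k)))//.
  by apply/funext => k /=; rewrite fP.
Qed.

Lemma copies_setT : copies S setT.
Proof.
apply/copiesP; exists id; split; first exact: embedding_id.
by rewrite image_id.
Qed.

(** A partial map is encoded by its graph, so that adding a point is a union. The equivalence in the
    first clause makes the graph both single-valued and injective. *)
Definition partial_iso G : Prop :=
  (forall p q, G p -> G q -> (p.1 = q.1 <-> p.2 = q.2)) /\
  forall (i : symbol Lg) (t : 'I_(arity i) -> X * X), (forall k, G (t k)) ->
    (interp S i (fst \o t) <-> interp S i (snd \o t)).

Lemma partial_iso_graph e G :
  embedding e -> (forall p, G p -> e p.1 = p.2) -> partial_iso G.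
Proof.
move=> [einj eP] Ge; split=> [p q Gp Gq|i t Gt].
  by rewrite -(Ge p)// -(Ge q)//; split=> [->//|/einj].
by rewrite eP (_ : e \o (fst \o t) = snd \o t)//; apply/funext => k; apply: Ge.
Qed.

(** Carries ultrahomogeneity over to graphs: choosing partners in both directions between the two
    projections of [G] gives mutually inverse maps of subtypes. *)
Lemma partial_iso_extends G : ultrahomogeneous S -> finite_set G ->
  partial_iso G ->
  exists g, isomorphism S S g /\ forall p, G p -> g p.1 = p.2.
Proof.
move=> Suh Gfin [Ginj GP].
pose A := fst @` G; pose B := snd @` G.
have /choice[f fP] (a : set_type A) : exists b : set_type B, G (val a, val b).
  have [[x y] Gxy /= <-] := set_mem (valP a).
  have yB : B y by exists (x, y).
  by exists (SigSub (mem_set yB)).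
have /choice[f' f'P] (b : set_type B) : exists a : set_type A, G (val a, val b).
  have [[x y] Gxy /= <-] := set_mem (valP b).
  have xA : A x by exists (x, y).
  by exists (SigSub (mem_set xA)).
have [|g [giso gf]] := Suh A B f (finite_image _ Gfin) (finite_image _ Gfin).
  split.
    exists f' => [a|b]; apply: val_inj.
      exact: (Ginj _ _ (f'P (f a)) (fP a)).2.
    exact: (Ginj _ _ (fP (f' b)) (f'P b)).1.
  by move=> i t /=; apply: (GP i (fun k => (val (t k), val (f (t k))))).
exists g; split=> // -[x y] Gxy /=.
have xA : A x by exists (x, y).
have /= -> := gf (SigSub (mem_set xA)).
exact: (Ginj _ _ (fP (SigSub (mem_set xA))) Gxy).1.
Qed.

(** The new point [x] ranges over all of [X]; only the values are confined to [A]. *)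
Definition one_point_extension A : Prop :=
  forall G x, finite_set G -> partial_iso G -> (forall p, G p -> A p.2) ->
    exists a, A a /\ partial_iso ((x, a) |` G).

(** Pull the values of [G] back along an embedding [e] with range [A], extend the result to an
    automorphism [g], and take [e (g x)] as the new value. *)
Lemma copies_one_point_extension A : ultrahomogeneous S ->
  copies S A -> one_point_extension A.
Proof.
move=> Suh /copiesP[e [eemb <-]] G x Gfin Giso Ge.
have [einj eP] := eemb.
pose u (p : X * X) := (p.1, e p.2).
have uinj : injective u by move=> [a b] [c d] [/= -> /einj ->].
have [||g [giso gG]] := @partial_iso_extends (u @^-1` G) Suh.
- by apply: finite_preimage => // p q _ _ /uinj.
- case: Giso => Ginj GP; split=> [p q Gp Gq|i t Gt].
    rewrite (Ginj _ _ Gp Gq) /=; split=> [/einj//|->//].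
  by rewrite (eP i (snd \o t)); apply: (GP i (u \o t)).
exists (e (g x)); split; first by exists (g x).
apply: (@partial_iso_graph (e \o g)).
  exact: embedding_comp eemb (isomorphism_embedding giso).
move=> p [->//|Gp]; have [y _ ey] := Ge _ Gp.
by rewrite /= (gG (p.1, y)) //= /u /= ey; case: p Gp {ey}.
Qed.

(** * The back-and-forth construction *)

Section BackAndForth.
Variable A : set X.

Let good G := [/\ finite_set G, partial_iso G & forall p, G p -> A p.2].

(** The forth half is the extension property of [A]; the back half takes the preimage of [y] under
    an automorphism extending the graph so obtained. *)
Lemma back_and_forth_step G y : ultrahomogeneous S -> one_point_extension A ->
  good G -> exists G', [/\ good G', G `<=` G', exists a, G' (y, a) &
    A y -> exists x, G' (x, y)].
Proof.
move=> Suh Aext [Gfin Giso GA].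
have [a [Aa aiso]] := Aext G y Gfin Giso GA.
have G1A p : ((y, a) |` G) p -> A p.2 by move=> [->//|/GA].
have G1fin : finite_set ((y, a) |` G).
  by rewrite finite_setU; split=> //; exact: finite_set1.
case: (pselect (A y)) => [Ay|nAy]; last first.
  by exists ((y, a) |` G); split=> //; exists a; left.
have [g [giso gG]] := partial_iso_extends Suh G1fin aiso.
have [[g' gK g'K] _] := giso.
exists ((g' y, y) |` ((y, a) |` G)); split.
- split; first by rewrite finite_setU; split=> //; exact: finite_set1.
  + apply: partial_iso_graph (isomorphism_embedding giso) _ => p [->|/gG//].
    by rewrite /= g'K.
  + by move=> p [->//|/G1A].
- by move=> p Gp; right; right.
- by exists a; right; left.
- by exists (g' y); left.
Qed.

Lemma back_and_forth : countable [set: X] -> infinite_set [set: X] ->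
  ultrahomogeneous S -> one_point_extension A -> copies S A.
Proof.
move=> Xc Xinf Suh Aext; have [s [_ sX]] := countably_infinite_enum Xc Xinf.
have /choice[step stepP] (st : sig good * X) : exists st' : sig good,
    [/\ sval st.1 `<=` sval st', exists a, sval st' (st.2, a) &
    A st.2 -> exists x, sval st' (x, st.2)].
  case: st => -[G gG] y.
  by have [G' [gG' ? ? ?]] := back_and_forth_step y Suh Aext gG; exists (exist _ G' gG').
have good0 : good set0 by split; [exact: finite_set0|exact: partial_iso_graph (@embedding_id) _|].
(* Stage [k.+1] puts [s k] into the domain and, if [s k] lies in [A], into the range. The union of
   the stages is the graph of the embedding sought. *)
pose st n := iteri n (fun k z => step (z, s k)) (exist _ set0 good0).
pose G n := sval (st n).
have Ggood n : good (G n) by exact: (svalP (st n)).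
have Gmono m n : (m <= n)%N -> G m `<=` G n.
  move=> /subnK <-; elim: (n - m)%N => [//|k IHk] p Gp.
  by have [+ _ _] := stepP (st (k + m)%N, s (k + m)%N); apply; apply: IHk.
have sE x : exists n, s n = x by have [n _] : range s x by [rewrite sX]; exists n.
have /choice[e eP] x : exists a, exists n, G n (x, a).
  have [n <-] := sE x; have [_ [a Ga] _] := stepP (st n, s n).
  by exists a, n.+1.
(* Finitely many points are compared at the maximum of their stages [N]. *)
have /choice[N NP] x := eP x.
apply/copiesP; exists e; split; first split.
- move=> x y exy; pose M := maxn (N x) (N y).
  have [_ [Ginj _] _] := Ggood M.
  have Gx : G M (x, e x) by apply: Gmono (NP x); exact: leq_maxl.
  have Gy : G M (y, e y) by apply: Gmono (NP y); exact: leq_maxr.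
  exact: (Ginj _ _ Gx Gy).2.
- move=> i t; pose M := (\max_k N (t k))%N.
  have [_ [_ GP] _] := Ggood M.
  apply: (GP i (fun k => (t k, e (t k)))) => k.
  by apply: Gmono (NP (t k)); exact: (leq_bigmax k).
rewrite eqEsubset; split=> [_ [x _ <-]|y Ay].
  by have [_ _ /(_ _ (NP x))] := Ggood (N x).
have [n sn] := sE y; have [_ _ /=] := stepP (st n, s n).
rewrite sn => /(_ Ay)[x Gx]; exists x => //.
pose M := maxn (N x) n.+1; have [_ [Ginj _] _] := Ggood M.
have Gxe : G M (x, e x) by apply: Gmono (NP x); exact: leq_maxl.
have Gxy : G M (x, y).
  by apply: (Gmono n.+1); [exact: leq_maxr|rewrite /G /= sn].
exact: (Ginj _ _ Gxe Gxy).1.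
Qed.

End BackAndForth.

(** A finite graph has finitely many values, which lie in a single member of the chain; the
    extension is made inside that member. *)
Lemma copies_bigcup_chain (F : set (set X)) : countable [set: X] ->
  infinite_set [set: X] -> ultrahomogeneous S -> F !=set0 -> F `<=` copies S ->
  total_on F (fun A B => A `<=` B) -> copies S (\bigcup_(A in F) A).
Proof.
move=> Xc Xinf Suh F0 Fcop Ftot; apply: back_and_forth => // G x Gfin Giso GF.
have [|A [FA GA]] := finite_sub_chain F0 Ftot (finite_image snd Gfin).
  by move=> _ [p Gp <-]; apply: GF.
have [|a [Aa aiso]] :=
    copies_one_point_extension Suh (Fcop _ FA) x Gfin Giso.
  by move=> p Gp; apply: GA; exists p.
by exists a; split=> //; exists A.
Qed.

Lemma copies_nonempty A : [set: X] !=set0 -> copies S A -> A !=set0.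
Proof. by move=> [x _] /copiesP[e [_ <-]]; exists (e x), x. Qed.

Lemma copies0_bigcup_chain (F : set (set X)) : countable [set: X] ->
  infinite_set [set: X] -> ultrahomogeneous S ->
  F `<=` copies S `|` [set set0] -> total_on F (fun A B => A `<=` B) ->
  (copies S `|` [set set0]) (\bigcup_(A in F) A).
Proof.
move=> Xc Xinf Suh FP Ftot; pose F' := F `&` copies S.
have FE : \bigcup_(A in F) A = \bigcup_(A in F') A.
  rewrite eqEsubset; split=> x [A FA Ax]; last by exists A => //; case: FA.
  by exists A => //; split=> //; have [//|A0] := FP _ FA; rewrite A0 in Ax.
rewrite FE; have [F'0|/nonemptyPn->] := pselect (F' !=set0); last first.
  by right; rewrite bigcup_set0.
left; apply: copies_bigcup_chain => // [A []//|A B [FA _] [FB _]].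
exact: Ftot.
Qed.

(** If [A] is the range of [e] and [d] has a proper copy as range, then [e \o d] misses a point of
    [A] because [e] is injective. *)
Lemma copies_proper_sub A : copies S <> [set setT] -> copies S A ->
  exists B, copies S B /\ B `<` A.
Proof.
move=> Sne /copiesP[e [eemb <-]].
have [B [/copiesP[d [demb dB]] BT]] : exists B, copies S B /\ B <> setT.
  apply: contrapT => nB; apply: Sne; rewrite eqEsubset; split=> [B SB|_ ->].
    by apply: contrapT => BT; apply: nB; exists B.
  exact: copies_setT.
exists (range (e \o d)); split.
  by apply/copiesP; exists (e \o d); split=> //; exact: embedding_comp.
split=> [_ [x _ <-]|le_ed]; first by exists (d x).
apply: BT; rewrite -dB eqEsubset; split=> // x _.
have [|y _ /eemb.1 dyx] := le_ed (e x); first by exists x.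
by exists y.
Qed.

End Copies.

(** * Chains of sets *)

Section WeightedSum.
Variables (R : realType) (X : Type) (s : nat -> X).
Import Order.TTheory GRing.Theory Num.Theory.
Local Open Scope ring_scope.
Implicit Types A B : set X.

Let w n : R := 2^-1 ^+ n.+1.

Let w_gt0 n : 0 < w n.
Proof. by rewrite exprn_gt0// invr_gt0 ltr0n. Qed.

Let wsum A N := \sum_(n < N) (if `[< A (s n) >] then w n else 0).

Let wsum_term_ge0 A n : 0 <= (if `[< A (s n) >] then w n else 0).
Proof. by case: ifP => // _; exact: ltW. Qed.

Let wsum_le1 A N : wsum A N <= 1.
Proof.
have -> : 1 = \sum_(n < N) w n + 2^-1 ^+ N.
  elim: N => [|N IHN]; first by rewrite big_ord0 expr0 add0r.
  rewrite big_ord_recr /= {1}IHN -addrA; congr (_ + _).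
  by rewrite /w exprS -mulrDl -[X in X + X]mul1r -splitr mul1r.
rewrite -[leLHS]addr0 lerD ?exprn_ge0 ?invr_ge0//.
by apply: ler_sum => n _; case: ifP => // _; exact: ltW.
Qed.

(** The sum of the [w n] over all [n] with [s n] in [A], as the supremum of its partial sums, which
    are bounded by 1. *)
Definition weight A : R := sup (range (wsum A)).

Let wsum_le A N : wsum A N <= weight A.
Proof.
apply: ub_le_sup; last by exists N.
by exists 1 => _ [n _ <-]; exact: wsum_le1.
Qed.

Lemma weight_proper A B : range s = setT -> A `<` B -> weight A < weight B.
Proof.
move=> sT [AB /existsNP[x /not_implyP[Bx nAx]]].
have [n _ snx] : range s x by rewrite sT.
(* The index [n] contributes [w n] to the weight of [B] and nothing to that of [A]. *)
apply: (@lt_le_trans _ _ (weight A + w n)); first by rewrite ltrDl.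
rewrite -lerBrDr; apply: ge_sup; first by exists (wsum A 0), 0%N.
move=> _ [N _ <-]; rewrite lerBrDr.
(* The cutoff [n.+1 + N] includes the index [n] as well as the first [N] terms. *)
apply: le_trans (wsum_le B (n.+1 + N)).
have le_AN : wsum A N <= wsum A (n.+1 + N).
  rewrite addnC /wsum big_split_ord /= lerDl.
  by apply: sumr_ge0 => i _; exact: wsum_term_ge0.
apply: le_trans (lerD le_AN (lexx _)) _.
have nN : (n < n.+1 + N)%N by rewrite ltnS leq_addr.
rewrite /wsum (bigD1 (Ordinal nN))//= [leRHS](bigD1 (Ordinal nN))//= snx.
rewrite asboolF// asboolT// add0r [leLHS]addrC lerD2l.
apply: ler_sum => i _; case: asboolP => [/AB Bi|_]; first by rewrite asboolT.
exact: wsum_term_ge0.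
Qed.

End WeightedSum.

Lemma chain_lt_linear (X : Type) (C : set (set X)) :
  total_on C (fun A B => A `<=` B) -> linear_order (@chain_lt X C).
Proof.
move=> Ctot; split=> [a|a b c|a b ab]; first exact: properxx.
  move=> [ab nba] [bc ncb]; split; first exact: subset_trans ab bc.
  by move=> ca; apply: ncb; exact: subset_trans ca ab.
have ne : val a <> val b by move=> /val_inj.
have [] := Ctot _ _ (set_mem (valP a)) (set_mem (valP b)) => le.
  by left; split=> // ge; apply: ne; rewrite eqEsubset.
by right; split=> // ge; apply: ne; rewrite eqEsubset.
Qed.

Lemma chain_R_embeddable (R : realType) (X : Type) (C : set (set X)) :
  countable [set: X] -> infinite_set [set: X] ->
  total_on C (fun A B => A `<=` B) -> R_embeddable (@chain_lt X C) R.
Proof.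
move=> Xc Xinf Ctot; have [s [_ sX]] := countably_infinite_enum Xc Xinf.
pose f (a : set_type C) : R := weight R s (val a).
have fmono a b : chain_lt a b -> (f a < f b)%R.
  by move=> ab; exact: weight_proper.
have [_ _ tri] := chain_lt_linear Ctot.
exists f; split=> [a b fab|a b].
  apply: contrapT => /tri[] /fmono; rewrite fab; by rewrite Order.POrderTheory.ltxx.
split=> [/fmono//|fab]; apply: contrapT => nab.
have [ab|/tri[]//] := pselect (a = b).
  by move: fab; rewrite ab Order.POrderTheory.ltxx.
move=> /fmono fba; have := Order.POrderTheory.lt_trans fab fba.
by rewrite Order.POrderTheory.ltxx.
Qed.

Lemma maximal_chain_mem (X : Type) (P C : set (set X)) (A : set X) :
  maximal_chain P C -> P A -> (forall B, C B -> A `<=` B \/ B `<=` A) -> C A.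
Proof.
move=> [CP Ctot Cmax] PA AC.
rewrite -(Cmax (A |` C)); first by left.
- by move=> B [->//|/CP].
- move=> B D [->|CB] [->|CD]; [by left|exact: AC| |exact: Ctot].
  by have [] := AC _ CB; [right|left].
- by move=> B CB; right.
Qed.

(** * Maximal chains in a family closed under unions of chains *)

Section MaximalChain.
Variables (X : Type) (P C : set (set X)).
Hypotheses (PT : P setT) (C_max : maximal_chain P C).
Hypothesis P_bigcup : forall F : set (set X), F `<=` P ->
  total_on F (fun A B => A `<=` B) -> P (\bigcup_(A in F) A).

(** The union is comparable with each [B] in [C]: either some member of [F] is not inside [B], hence
    contains it, or all members are inside [B]. *)
Lemma maximal_chain_bigcup (F : set (set X)) :
  F `<=` C -> C (\bigcup_(A in F) A).
Proof.
move=> FC; have [CP Ctot _] := C_max.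
apply: (maximal_chain_mem C_max).
  by apply: P_bigcup => [A /FC /CP//|A B /FC CA /FC CB]; exact: Ctot.
move=> B CB; have [[A [FA nAB]]|nA] := pselect (exists A, F A /\ ~ (A `<=` B)).
  right; have [//|BA] := Ctot _ _ (FC _ FA) CB.
  by move=> x /BA Ax; exists A.
left=> x [A FA Ax]; suff: A `<=` B by apply.
by apply: contrapT => nAB; apply: nA; exists A.
Qed.

Lemma maximal_chain_set0 : C set0.
Proof. by rewrite -(bigcup_set0 id); apply: maximal_chain_bigcup. Qed.

Lemma chain_set0_least o : val o = set0 -> is_least (@chain_lt X C) setT o.
Proof.
move=> o0; split=> // a _ ao; rewrite /chain_lt o0; split=> // a0.
apply: ao; apply: val_inj; rewrite o0 eqEsubset; split=> //.
Qed.

Lemma maximal_chain_complete : complete_linear_order (@chain_lt X C).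
Proof.
have [CP Ctot _] := C_max.
split.
- exact: chain_lt_linear.
- exists (SigSub (mem_set maximal_chain_set0)).
  exact: chain_set0_least.
- have CT : C setT by apply: (maximal_chain_mem C_max) => // B _; right.
  exists (SigSub (mem_set CT)); split=> // a _ aT; split=> // Ta.
  by apply: aT; apply: val_inj; rewrite /= eqEsubset.
- move=> [A [B [[_ _] AB lt_AB noA noB]]].
  have /maximal_chain_bigcup CU : [set val a | a in A] `<=` C.
    by move=> _ [a _ <-]; exact: set_mem (valP a).
  set U := \bigcup_(_ in _) _ in CU.
  pose u : set_type C := SigSub (mem_set CU).
  have leU a : A a -> val a `<=` U by move=> Aa x ax; exists (val a) => //; exists a.
  have : (A `|` B) u by rewrite AB.
  move=> [Au|Bu].
    apply: noA; exists u; split=> // a Aa au; split; first exact: leU.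
    by move=> Ua; apply: au; apply: val_inj; rewrite eqEsubset; split=> //; exact: leU.
  apply: noB; exists u; split=> // b Bb bu; split.
    by move=> x [_ [a Aa <-]] ax; have [+ _] := lt_AB _ _ Aa Bb; apply.
  move=> bU; apply: bu; apply: val_inj; rewrite eqEsubset; split=> //=.
  by move=> x [_ [a Aa <-]] ax; have [+ _] := lt_AB _ _ Aa Bb; apply.
Qed.

(** Take [B] properly inside a supposed immediate successor [a] of the empty set. Every nonempty
    member of the chain contains [a], so [B] is comparable with the whole chain, belongs to it, and
    lies strictly between. *)
Lemma maximal_chain_non_isolated o : val o = set0 ->
  (forall A, P A -> A !=set0 -> exists B, [/\ P B, B !=set0 & B `<` A]) ->
  non_isolated (@chain_lt X C) o.
Proof.
move=> o0 Psub [a [[_ oa] noz]]; have [CP Ctot _] := C_max.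
have a0 : val a !=set0.
  by apply/set0P/eqP => a0; apply: oa; rewrite a0.
have [B [PB B0 Ba]] := Psub _ (CP _ (set_mem (valP a))) a0.
have CB : C B.
  apply: (maximal_chain_mem C_max) => // D CD.
  have [->|/set0P[x Dx]] := eqVneq D set0; first by right.
  left; apply: subset_trans (properW Ba) _.
  have [//|Da] := Ctot _ _ (set_mem (valP a)) CD.
  apply: contrapT => naD; apply: noz; exists (SigSub (mem_set CD)).
  by rewrite /chain_lt /= o0; split; split=> // /(_ _ Dx).
apply: noz; exists (SigSub (mem_set CB)); split=> //.
by rewrite /chain_lt /= o0; case: B0 => x Bx; split=> // /(_ _ Bx).
Qed.

End MaximalChain.

(** * Countable complete linear orders *)

Section LinearOrderTheory.
Variables (T : Type) (lt : T -> T -> Prop).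
Hypothesis lt_linear : linear_order lt.

Definition le_of (x y : T) : Prop := x = y \/ lt x y.
Local Notation le := le_of.

Lemma lo_irr x : ~ lt x x.
Proof. by case: lt_linear. Qed.

Lemma lo_trans y x z : lt x y -> lt y z -> lt x z.
Proof. by case: lt_linear => _ + _; apply. Qed.

Lemma lo_lt_asym x y : lt x y -> ~ lt y x.
Proof. by move=> xy yx; exact: lo_irr (lo_trans xy yx). Qed.

Lemma lo_le_lt_trans y x z : le x y -> lt y z -> lt x z.
Proof. by move=> [->//|]; exact: lo_trans. Qed.

Lemma lo_lt_le_trans y x z : lt x y -> le y z -> lt x z.
Proof. by move=> xy [<-//|]; exact: lo_trans xy. Qed.

Lemma lo_le_trans y x z : le x y -> le y z -> le x z.
Proof. by move=> [->//|xy] yz; right; exact: lo_lt_le_trans xy yz. Qed.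

Lemma lo_le_ltN x y : le x y -> ~ lt y x.
Proof. by move=> xy yx; exact: lo_irr (lo_le_lt_trans xy yx). Qed.

Lemma lo_leP x y : le x y \/ lt y x.
Proof.
have [->|xy] := pselect (x = y); first by left; left.
by case: lt_linear => _ _ /(_ _ _ xy)[xy'|]; [left; right|right].
Qed.

Lemma is_least_le A o x : is_least lt A o -> A x -> le o x.
Proof.
move=> [_ omin] Ax; have [->|xo] := pselect (x = o); first by left.
by right; exact: omin.
Qed.

End LinearOrderTheory.

(** * Suprema and jumps in a complete order *)

Section CompleteOrder.
Variables (T : Type) (lt : T -> T -> Prop).
Hypothesis lt_complete : complete_linear_order lt.
Local Notation le := (le_of lt).

Let lt_linear : linear_order lt. Proof. by case: lt_complete. Qed.

(** Unless one side is empty, the downward closure of [E] and its complement form a cut that is not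
    a gap; [s] is the maximum of the former or the minimum of the latter. For empty [E], [s] is the
    least element. *)
Lemma complete_lub (E : set T) : exists s,
  (forall x, E x -> le x s) /\ forall x, lt x s -> exists2 e, E e & lt x e.
Proof.
have [_ [o [_ omin]] [m [_ mmax]] nogap] := lt_complete.
have [[e0 Ee0]|/nonemptyPn E0] := pselect (E !=set0); last first.
  exists o; rewrite E0; split=> // x xo; exfalso.
  have := lo_le_ltN lt_linear _ xo; apply.
  by apply: (@is_least_le _ _ setT).
pose A := [set t | exists2 e, E e & le t e]; pose B := ~` A.
have EA x : E x -> A x by move=> Ex; exists x => //; left.
have [[b0 Bb0]|/nonemptyPn B0] := pselect (B !=set0); last first.
  have [e Ee me] : A m by apply: contrapT => nAm; have : B m by []; rewrite B0.
  have lem x : le x m.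
    have [->|/mmax mx] := pselect (x = m); first by left.
    by right; exact: mx.
  exists m; split=> [x _|x xm]; first exact: lem.
  by exists e => //; exact: lo_lt_le_trans xm me.
have lt_AB a b : A a -> B b -> lt a b.
  move=> [e Ee ae] Bb; have [ba|//] := lo_leP lt_linear b a.
  by exfalso; apply: Bb; exists e => //; exact: lo_le_trans ba ae.
have [[x [[e Ee xe] xmax]]|noA] := pselect (exists x, is_greatest lt A x).
  exists x; split=> [y /EA Ay|y yx].
    by have [->|/(xmax _ Ay)] := pselect (y = x); [left|right].
  by exists e => //; exact: lo_lt_le_trans yx xe.
have [b [Bb bmin]] : exists b, is_least lt B b.
  apply: contrapT => noB; apply: nogap; exists A, B; split=> //.
  - by split; [exists e0; exact: EA|exists b0].
  - exact: setUCr.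
exists b; split=> [y /EA Ay|x xb]; first by right; exact: lt_AB.
have Ax : A x.
  apply: contrapT => /(is_least_le (conj Bb bmin)) bx.
  exact: lo_le_ltN bx xb.
apply: contrapT => nex; apply: noA; exists x; split=> // y [e Ee ye] yx.
have [[xy|xy]|//] := lo_leP lt_linear x y; first by case: yx.
by exfalso; apply: nex; exists e => //; exact: lo_lt_le_trans xy ye.
Qed.

(* Without a jump between [x] and [y] the interval is dense, and nested
   intervals [a n, b n] avoiding [t n] produce a point missed by [t]. *)
Lemma countable_complete_jump (t : nat -> T) x y : range t = setT -> lt x y ->
  exists u v, [/\ immediate_successor lt u v, le x u & le v y].
Proof.
move=> tT xy; apply: contrapT => nojump.
have dense a b : le x a -> lt a b -> le b y -> exists c, lt a c /\ lt c b.
  move=> xa ab by_; apply: contrapT => nc; apply: nojump.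
  by exists a, b.
pose good (p : T * T) := [/\ le x p.1, lt p.1 p.2 & le p.2 y].
have /choice[step stepP] (q : sig good * nat) : exists q' : sig good,
    [/\ le (sval q.1).1 (sval q').1, le (sval q').2 (sval q.1).2 &
        lt (t q.2) (sval q').1 \/ lt (sval q').2 (t q.2)].
  case: q => -[[a b] gp] n; have [/= xa ab ley] := gp.
  (* With [c < d] inside the interval, keep [(d, b)] if [t n] is at most [c], and [(a, c)]
     otherwise; the second point [d] handles the case [t n = c]. *)
  have [c [ac cb]] := dense _ _ xa ab ley.
  have [d [cd db]] := dense _ _ (lo_le_trans lt_linear xa (or_intror ac)) cb ley.
  have [tc|ct] := lo_leP lt_linear (t n) c.
    have gdb : good (d, b).
      split=> //=; right; apply: (lo_le_lt_trans lt_linear xa).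
      exact: (lo_trans lt_linear ac).
    exists (exist _ (d, b) gdb) => /=; split.
    - by right; exact: (lo_trans lt_linear ac).
    - by left.
    - by left; exact: (lo_le_lt_trans lt_linear tc).
  have gac : good (a, c).
    by split=> //=; right; exact: (lo_lt_le_trans lt_linear cb).
  by exists (exist _ (a, c) gac) => /=; split; [left|right|right].
have good0 : good (x, y) by split=> //=; left.
pose q n := iteri n (fun k z => step (z, k)) (exist _ (x, y) good0).
pose a n := (sval (q n)).1; pose b n := (sval (q n)).2.
have amono m n : (m <= n)%N -> le (a m) (a n).
  move=> /subnK <-; elim: (n - m)%N => [|k IHk]; first by left.
  apply: (lo_le_trans lt_linear IHk).
  by have [] := stepP (q (k + m)%N, (k + m)%N).
have bmono m n : (m <= n)%N -> le (b n) (b m).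
  move=> /subnK <-; elim: (n - m)%N => [|k IHk]; first by left.
  apply: (lo_le_trans lt_linear) IHk.
  by have [] := stepP (q (k + m)%N, (k + m)%N).
have ab m n : lt (a m) (b n).
  have abM : lt (a (maxn m n)) (b (maxn m n)).
    by have [] := svalP (q (maxn m n)).
  apply: (lo_le_lt_trans lt_linear (amono _ _ (leq_maxl m n))).
  exact: (lo_lt_le_trans lt_linear abM (bmono _ _ (leq_maxr m n))).
(* The supremum of the left ends lies in all the closed intervals, but the stage treating its own
   index has excluded it. *)
have [s [ub_s lub_s]] := complete_lub (range a).
have [n _ tn] : range t s by rewrite tT.
have [_ _] := stepP (q n, n); rewrite /= tn => -[sa|bs].
  have /(lo_le_ltN lt_linear) := ub_s (a n.+1) (imageT _ _); exact.
have [_ [m _ <-] bam] := lub_s _ bs.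
exact: (lo_lt_asym lt_linear bam (ab m n.+1)).
Qed.

End CompleteOrder.

Lemma infinite_range_inj (T : Type) (f : nat -> T) :
  injective f -> infinite_set (range f).
Proof.
move=> finj ffin; apply: infinite_nat.
have -> : [set: nat] = f @^-1` range f by rewrite eqEsubset; split=> // n _; exists n.
by apply: finite_preimage => // m n _ _ /finj.
Qed.

(** * Labelling the jumps of a countable complete order *)

Section JumpLabelling.
Variables (T : Type) (lt : T -> T -> Prop).
Hypotheses (T_countable : countable [set: T]) (T_infinite : infinite_set [set: T]).
Hypothesis lt_complete : complete_linear_order lt.
Variable o : T.
Hypotheses (o_least : is_least lt setT o) (o_non_isolated : non_isolated lt o).
Local Notation le := (le_of lt).

Let lt_linear : linear_order lt. Proof. by case: lt_complete. Qed.

(** A jump is represented by its upper end, which determines it. *)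
Definition jump_tops : set T := [set v | exists u, immediate_successor lt u v].

Lemma jump_tops_gt_least v : jump_tops v -> lt o v.
Proof.
by move=> [u [uv _]]; apply: (lo_le_lt_trans lt_linear) uv; exact: is_least_le o_least _.
Qed.

Lemma jump_top_between x y : lt x y ->
  exists v, [/\ jump_tops v, lt x v & le v y].
Proof.
have [t [_ tT]] := countably_infinite_enum T_countable T_infinite.
move=> /(countable_complete_jump lt_complete tT)[u [v [uv xu vy]]].
exists v; split=> //; first by exists u.
exact: (lo_le_lt_trans lt_linear xu uv.1).
Qed.

(** Non-isolation of [o] gives a jump top strictly below any point above [o]. The sequence is chosen
    to descend, passing below the points of an enumeration of [T] one after another. *)
Lemma jump_tops_coinitial : exists v : nat -> T,
  [/\ forall n, jump_tops (v n),
      forall m n, (m < n)%N -> lt (v n) (v m) &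
      forall x, lt o x -> exists n, le (v n) x].
Proof.
have [t [_ tT]] := countably_infinite_enum T_countable T_infinite.
have below y : lt o y -> exists2 v, jump_tops v & lt v y.
  move=> oy; have [z [oz zy]] : exists z, lt o z /\ lt z y.
    by apply: contrapT => nz; apply: o_non_isolated; exists y.
  have [v [Jv _ vz]] := jump_top_between oz.
  by exists v => //; exact: (lo_le_lt_trans lt_linear vz zy).
have [y oy] : exists y, lt o y.
  apply: contrapT => ny; apply: T_infinite.
  apply: sub_finite_set (finite_set1 o) => x _.
  by have [//|ox] := is_least_le o_least (I : setT x); case: ny; exists x.
have [v0 Jv0 _] := below _ oy.
have /choice[step stepP] (q : sig jump_tops * nat) : exists q' : sig jump_tops,
    lt (sval q') (sval q.1) /\ (lt o (t q.2) -> lt (sval q') (t q.2)).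
  case: q => -[v Jv] n /=; have ov := jump_tops_gt_least Jv.
  have [z [oz zv zt]] : exists z,
      [/\ lt o z, le z v & lt o (t n) -> le z (t n)].
    have [vt|tv] := lo_leP lt_linear v (t n); first by exists v; split=> //; left.
    have [ot|not] := pselect (lt o (t n)); last by exists v; split=> //; left.
    by exists (t n); split=> //; [right|left].
  have [v' Jv' v'z] := below _ oz.
  exists (exist _ v' Jv') => /=; split; first exact: (lo_lt_le_trans lt_linear v'z zv).
  by move=> /zt; exact: (lo_lt_le_trans lt_linear v'z).
pose q n := iteri n (fun k z => step (z, k)) (exist _ v0 Jv0).
exists (fun n => sval (q n)); split=> [n|m n|x ox]; first exact: svalP (q n).
  elim: n => // n IHn; rewrite ltnS leq_eqVlt => /orP[/eqP->|/IHn nm].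
    by have [] := stepP (q n, n).
  by apply: (lo_trans lt_linear) nm; have [] := stepP (q n, n).
have [n _ tn] : range t x by rewrite tT.
by exists n.+1; right; have [_] := stepP (q n, n); rewrite /= tn; apply.
Qed.

(** The points of [A] get labels descending to [o], so only finitely many of these labels exceed a
    given [x] above [o]; the other points of [X] take up the remaining jumps. *)
Lemma jump_labelling (X : Type) (A : set X) : countable [set: X] ->
  infinite_set A -> infinite_set (~` A) ->
  exists h : X -> T, [/\ injective h, range h = jump_tops &
    forall x, lt o x -> finite_set (A `\` [set p | le (h p) x])].
Proof.
move=> Xc Ai nAi; have subc B : countable (B : set X).
  by apply: sub_countable Xc; apply: subset_card_le.
have [a [ainj aA]] := countably_infinite_enum (subc A) Ai.
have [b [binj bA]] := countably_infinite_enum (subc (~` A)) nAi.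
have [v [Jv vmono vcoin]] := jump_tops_coinitial.
have vinj : injective v.
  move=> m n vmn; have [/vmono|/vmono|//] := ltngtP m n;
    by rewrite vmn => /(lo_irr lt_linear).
(* The even terms of [v] label [A]; the odd ones keep the remaining jumps
   infinite, so that these can label the complement of [A]. *)
pose V := range (v \o double).
have Wi : infinite_set (jump_tops `\` V).
  apply: (@sub_infinite_set _ (range (fun n => v n.*2.+1))).
    move=> _ [n _ <-]; split; first exact: Jv.
    by move=> [m _ /vinj /(congr1 odd)]; rewrite /= !odd_double.
  by apply: infinite_range_inj => m n /vinj [/double_inj].
have Wc : countable (jump_tops `\` V).
  by apply: sub_countable T_countable; apply: subset_card_le.
have [w [winj wW]] := countably_infinite_enum Wc Wi.
have wP n : (jump_tops `\` V) (w n) by rewrite -wW; exists n.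
have aP n : A (a n) by rewrite -aA; exists n.
have bP n : ~ A (b n) by have : (~` A) (b n) by [rewrite -bA; exists n].
have /choice[h hP] p : exists z, exists n,
    (p = a n /\ z = v n.*2) \/ (p = b n /\ z = w n).
  have [pA|pA] := pselect (A p).
    have [n _ an] : range a p by rewrite aA.
    by exists (v n.*2), n; left.
  have [n _ bn] : range b p by rewrite bA.
  by exists (w n), n; right.
have ha n : h (a n) = v n.*2.
  have [m [[/ainj<-//]|[E _]]] := hP (a n).
  by case: (bP m); rewrite -E.
have hb n : h (b n) = w n.
  have [m [[E _]|[/binj<-//]]] := hP (b n).
  by case: (bP n); rewrite E.
exists h; split.
- move=> p p'; have [m [[-> ->]|[-> ->]]] := hP p; have [n [[-> ->]|[-> ->]]] := hP p'.
  + by move=> /vinj/double_inj ->.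
  + by move=> E; case: (wP n) => _ []; exists m.
  + by move=> E; case: (wP m) => _ []; exists n.
  + by move=> /winj ->.
- rewrite eqEsubset; split=> [_ [p _ <-]|z Jz].
    by have [m [[_ ->]|[_ ->]]] := hP p; [exact: Jv|case: (wP m)].
  have [[n _ /= <-]|nVz] := pselect (V z); first by exists (a n).
  have [n _ <-] : range w z by rewrite wW.
  by exists (b n).
(* For [n >= N] also [n.*2 >= N], so the label of [a n] is at most [v N]; the exceptions are among
   the [a n] with [n < N]. *)
- move=> x /vcoin[N vNx]; apply: sub_finite_set (finite_image a (finite_II N)).
  move=> p [Ap /= nle]; have [n _ an] : range a p by rewrite aA.
  exists n => //=; rewrite ltnNge; apply/negP => Nn; apply: nle.
  rewrite -an ha; have : (N <= n.*2)%N by rewrite (leq_trans Nn)// -addnn leq_addr.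
  rewrite leq_eqVlt => /orP[/eqP<-//|/vmono vn].
  by apply: (lo_le_trans lt_linear) vNx; right.
Qed.

(* Each member of the chain is an initial segment of jumps; such a chain is
   maximal already in the full power set of [X]. *)
Lemma jump_labelling_maximal (X : Type) (h : X -> T) (Q : set (set X)) :
  injective h -> range h = jump_tops ->
  (forall x, Q [set p | le (h p) x]) ->
  let C := range (fun x => [set p | le (h p) x]) in
  maximal_chain Q C /\ order_isomorphic lt (@chain_lt X C).
Proof.
move=> hinj hJ DQ; set D := fun x => _; move=> C.
have hP p : jump_tops (h p) by rewrite -hJ; exists p.
have Dmono x y : le x y -> D x `<=` D y.
  by move=> xy p /= hx; exact: (lo_le_trans lt_linear hx xy).
have Dlt x y : lt x y -> D x `<` D y.
  move=> xy; split; first by apply: Dmono; right.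
  have [v [Jv xv vy]] := jump_top_between xy.
  have [p _ hp] : range h v by rewrite hJ.
  by move=> /(_ p); rewrite /D /= hp => /(_ vy) /(lo_le_ltN lt_linear).
have Dinj x y : D x = D y -> x = y.
  move=> Dxy; have [[//|/Dlt]|/Dlt] := lo_leP lt_linear x y;
    by rewrite Dxy => /properxx.
split; last first.
  pose f x : set_type C := SigSub (mem_set (imageT D x)).
  exists f; split.
    have /choice[g gP] (c : set_type C) : exists x, D x = val c.
      by have [x _ <-] := set_mem (valP c); exists x.
    exists g => [x|c]; first by apply: Dinj; rewrite gP.
    by apply: val_inj; rewrite /= gP.
  move=> x y; split=> [/Dlt//|xy].
  have [yx|//] := lo_leP lt_linear y x.
  by case: xy => _ /(_ (Dmono _ _ yx)).
split=> [_ [x _ <-]|_ _ [x _ <-] [y _ <-]|E EQ Etot CE]; first exact: DQ.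
  have [/Dmono|yx] := lo_leP lt_linear x y; first by left.
  by right; apply: Dmono; right.
rewrite eqEsubset; split=> // B EB.
have cmp x : D x `<=` B \/ B `<=` D x.
  by apply: Etot => //; apply: CE; exists x.
have [s [ub_s lub_s]] := complete_lub lt_complete [set x | D x `<=` B].
have DsB : D s `<=` B.
  move=> p hps; have [u [uhp nouhp]] := hP p.
  (* The lower end [u] of the jump at [h p] is below [s], so some [D x] inside [B] has [x] above
     [u], hence at least [h p]. *)
  have [x DxB ux] := lub_s _ (lo_lt_le_trans lt_linear uhp hps).
  apply: DxB; have [//|xh] := lo_leP lt_linear (h p) x.
  by case: nouhp; exists x.
have DB y : lt s y -> B `<=` D y.
  by move=> sy; have [/ub_s/(lo_le_ltN lt_linear)|] := cmp y.
exists s => //; rewrite eqEsubset; split=> // p Bp.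
have [//|shp] := lo_leP lt_linear (h p) s.
have [u [uhp nouhp]] := hP p.
(* If [s = u], then [D (h p)] adds only [p] to [D s] and is inside [B], so [h p] is at most [s]. If
   [s < u], then [B] is inside [D u], which omits [p]. If [u < s], then [s] lies inside the jump. *)
have [[su|su]|us] := lo_leP lt_linear s u.
- subst u; exfalso; apply: (lo_le_ltN lt_linear) shp; apply: ub_s => r /=.
  move=> [/hinj->//|hrp]; apply: DsB.
  have [//|shr] := lo_leP lt_linear (h r) s.
  by case: nouhp; exists (h r).
- by have /(lo_le_ltN lt_linear) := DB _ su _ Bp.
- by case: nouhp; exists s.
Qed.

End JumpLabelling.

Theorem theorem2p2 (R : realType) (Lg : language) (X : Type)
    (S : rel_structure Lg X)
    (Lg_countable : countable [set: symbol Lg])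
    (X_countable : countably_infinite X)
    (S_ultrahomogeneous : ultrahomogeneous S)
    (S_copies : copies S <> [set [set: X]]) :
  (forall C : set (set X),
     maximal_chain (copies S `|` [set set0]) C ->
     [/\ R_embeddable (@chain_lt X C) R,
         complete_linear_order (@chain_lt X C) &
         exists o : set_type C,
           [/\ val o = set0,
               is_least (@chain_lt X C) setT o &
               non_isolated (@chain_lt X C) o]])
  /\
  ((exists P : set (set X), positive_family P /\ P `<=` copies S) ->
   forall (T : Type) (lt : T -> T -> Prop),
     countably_infinite T ->
     complete_linear_order lt ->
     least_non_isolated lt ->
     exists C : set (set X),
       maximal_chain (copies S `|` [set set0]) C /\
       order_isomorphic lt (@chain_lt X C)).
Proof.
have [Xc Xi] := countably_infiniteP X_countable.
split.
  move=> C Cmax; have [CP Ctot _] := Cmax.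
  have PU F := @copies0_bigcup_chain _ _ S F Xc Xi S_ultrahomogeneous.
  have PT : (copies S `|` [set set0]) setT by left; exact: copies_setT.
  split; first exact: chain_R_embeddable.
    exact: maximal_chain_complete PT Cmax PU.
  pose o : set_type C := SigSub (mem_set (maximal_chain_set0 Cmax PU)).
  exists o; split=> //; first exact: chain_set0_least.
  apply: (maximal_chain_non_isolated Cmax) => // A [SA _|-> [//]].
  have [B [SB BA]] := copies_proper_sub S_copies SA.
  exists B; split=> //; first by left.
  by apply: copies_nonempty SB; have [x _] := infinite_setN0 Xi; exists x.
move=> [P [[P0 PS PF [A [PA nAi]]] Pcop]] T lt /countably_infiniteP[Tc Ti] ltC oni.
(* If [A] were finite, removing it would put the empty set into [P]. *)
have Ai : infinite_set A by move=> /(PF _ _ PA); rewrite setDv.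
have [_ [o omin] _ _] := ltC.
have [h [hinj hJ hfin]] :=
  jump_labelling Tc Ti ltC omin (oni _ omin) Xc Ai nAi.
eexists; apply: (jump_labelling_maximal Tc Ti ltC hinj hJ) => x.
(* For [x = o] the set is empty, since upper ends of jumps lie above [o]. *)
have [<-|ox] := is_least_le omin (I : setT x).
  right; rewrite /= -subset0 => p /= hp.
  have : jump_tops lt (h p) by rewrite -hJ; exists p.
  move=> /(jump_tops_gt_least ltC omin).
  by apply: lo_le_ltN hp; case: ltC.
(* For [x] above [o], deleting finitely many points from [A] leaves a member of [P] inside the
   set. *)
left; apply: Pcop; apply: PS (PF _ _ PA (hfin _ ox)) _.
by rewrite setDD => p [].
Qed.
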